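(* Suppose that $(Y(t))_{t\in\mathbb{R}^d}$ is a causal CARMA$(p,q)$ random field such that for each $i=1,\dots,d$ the polynomial $a_i(\cdot)$ (whose companion matrix is $A_i$) has distinct roots. Let $a_i(z)=\sum_{l=0}^p\alpha_{i,l}z^{p-l}$ and define the polynomials $$a_{i,k}(z):=\sum_{l=0}^{p-k}\alpha_{i,l}z^{p-k-l},\qquad k=1,\dots,p,\ i=1,\dots,d.$$ Then the kernel $g(s)=b^\top e^{A_1s_1}\cdots e^{A_ds_d}c\,1_{\{s\ge0\}}$ of $Y$ can be written as $$g(s)=\sum_{\lambda_1}\cdots\sum_{\lambda_d}\left(\sum_{k_1=1}^p\cdots\sum_{k_d=1}^p b_{k_1-1}\frac{\lambda_d^{k_d-1}}{a_d'(\lambda_d)}\prod_{i=1}^{d-1}\frac{\lambda_i^{k_i-1}a_{i,k_{i+1}}(\lambda_i)}{a_i'(\lambda_i)}\right)e^{\lambda_1s_1+\cdots+\lambda_ds_d}1_{\{s\ge0\}},\quad s\in\mathbb{R}^d,$$ where $\sum_{\lambda_i}$ denotes the sum over the distinct eigenvalues of $A_i$ (equivalently, the roots of $a_i$) and $a_i'$ is the derivative of $a_i$.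
   Context: The companion matrix of a monic polynomial $a(z)=z^p+\alpha_1z^{p-1}+\dots+\alpha_p$ is the $p\times p$ matrix with ones on the superdiagonal, last row $(-\alpha_p,-\alpha_{p-1},\dots,-\alpha_1)$ and zeros elsewhere (for $p=1$: $(-\alpha_1)$). A causal CARMA$(p,q)$ random field on $\mathbb{R}^d$ (integers $0\le q<p$) is given by $$Y(t)=b^\top X(t),\quad X(t)=\int_{-\infty}^{t_1}\cdots\int_{-\infty}^{t_d}e^{A_1(t_1-s_1)}\cdots e^{A_d(t_d-s_d)}c\,\Lambda(ds),\quad t\in\mathbb{R}^d,$$ where $b=(b_0,\dots,b_{p-1})^\top\in\mathbb{R}^p$ with $b_q\neq0$ and $b_i=0$ for $i>q$, $c=(0,\dots,0,1)^\top\in\mathbb{R}^p$, $A_i$ is the companion matrix of a real monic polynomial $a_i$ of degree $p$ whose roots have strictly negative real parts ($i=1,\dots,d$), and $\Lambda$ is a homogeneous Lévy basis on $\mathbb{R}^d$ (an infinitely divisible, independently scattered, stationary random measure) whose Lévy measure $\nu$ satisfies $\int_{\mathbb{R}}\log(|z|)^d1_{\{|z|>1\}}\nu(dz)<\infty$; the integral is a Rajput–Rosiński integral. Equivalently $Y(t)=\int_{\mathbb{R}^d}g(t-s)\Lambda(ds)$ with the kernel $g$ of the claim; the claim itself concerns only this deterministic kernel. Notation: $s\ge0$ is meant componentwise; empty products equal $1$; $z^0=1$. *)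

(* Defs.v *)
From HB Require Import structures.
From mathcomp Require Import all_boot all_order all_algebra.
From mathcomp Require Import all_classical all_reals all_analysis.
From mathcomp Require Import complex.

Set Implicit Arguments.
Unset Strict Implicit.
Unset Printing Implicit Defensive.

Import Order.TTheory GRing.Theory Num.Theory.
Import numFieldNormedType.Exports.

Local Open Scope classical_set_scope.
Local Open Scope ring_scope.
Local Open Scope complex_scope.

(* The limit is taken in the (sup-)norm topology of 'M[R]_n. *)
Definition expmx (R : realType) (n : nat) (A : 'M[R]_n) : 'M[R]_n :=
  limn (series (fun k : nat => k`!%:R^-1 *: A ^+ k)).

(* e^(x + iy) = e^x (cos y + i sin y) *)
Definition expC (R : realType) (z : R[i]) : R[i] :=
  (expR (complex.Re z))%:C * (cos (complex.Im z) +i* sin (complex.Im z)).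

Definition polyC_of_real (R : realType) (a : {poly R}) : {poly R[i]} :=
  map_poly (real_complex R) a.

(* The order p is a parameter, whereas the dimension of the library's
   companionmx a is (size a).-1; see companionE. *)
Definition companion (R : realType) (p : nat) (a : {poly R}) : 'M[R]_p :=
  \matrix_(i < p, j < p)
    if i.+1 == p then - a`_j else (j == i.+1 :> nat)%:R.

Lemma companionE (R : realType) (p : nat) (a : {poly R})
    (e : (size a).-1 = p) :
  companion p a = castmx (e, e) (companionmx a).
Proof.
case: p / e; apply/matrixP=> i j; rewrite castmx_id !mxE eq_sym.
have -> : ((size a).-1 == i.+1) = (i == (size a).-1.-1 :> nat).
  by case: (size a).-1 i {j} => [[]//|m] i /=; rewrite eqSS eq_sym.
by rewrite (eq_sym (j : nat)).
Qed.

(* All the roots of a in R[i] are simple: a is split by a duplicate-free list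
   of roots. *)
Definition distinct_roots (R : realType) (a : {poly R}) : Prop :=
  exists2 r : seq R[i], uniq r &
    polyC_of_real a = (lead_coef a)%:C *: \prod_(z <- r) ('X - z%:P).

(* With alpha_l := a`_(p - l), so that a(z) = \sum_(0 <= l <= p) alpha_l
   z^(p-l), this is \sum_(0 <= l <= p - k) alpha_l z^(p-k-l). *)
Definition truncated_poly (R : realType) (p : nat) (a : {poly R}) (k : nat) :
    {poly R} :=
  \sum_(l < (p - k).+1) a`_(p - l) *: 'X^(p - k - l).

Definition unit_vector_last (R : realType) (p : nat) : 'cV[R]_p :=
  \col_(i < p) (i.+1 == p)%:R.

Definition ge0_ind (R : realType) (d : nat) (s : 'cV[R]_d) : R :=
  [forall i, 0 <= s i 0]%:R.

(* The matrix product is taken in increasing order of the index i. *)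
Definition carma_kernel (R : realType) (d p : nat) (b : 'cV[R]_p)
    (A : 'I_d -> 'M[R]_p) (s : 'cV[R]_d) : R :=
  (b^T *m (\prod_(i < d) expmx (s i 0 *: A i)) *m unit_vector_last R p) 0 0
  * ge0_ind s.

(* The points (lambda_1, ..., lambda_d) with lambda_i a complex eigenvalue of
   A_i; summing over this finite set is the iterated sum over the distinct
   eigenvalues. *)
Definition eigenvalue_tuples (R : realType) (d p : nat)
    (A : 'I_d -> 'M[R]_p) : set {ffun 'I_d -> R[i]} :=
  [set lam | forall i, eigenvalue (map_mx (real_complex R) (A i)) (lam i)].

(* Main.v *)
(* If the roots r_j of the monic polynomial f of degree p are simple, the
   columns (r_j^(k-1))_k and the rows (f_l(r_j) / f'(r_j))_l, with 1 <= k, l <= p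
   and f_l = sum_(m >= l) alpha_m z^(m-l) for f = sum_m alpha_m z^m, are dual
   bases of eigenvectors of the companion matrix A: duality holds because the
   divided difference (f(z) - f(w)) / (z - w) = sum_l f_l(w) z^(l-1) vanishes at
   two distinct roots z, w and is f'(w) for z = w.  Hence
     (e^(tA))_(k,l) = sum_j r_j^(k-1) f_l(r_j) / f'(r_j) e^(t r_j),
   and the kernel is obtained by expanding the product of these matrices.  The
   matrix exponential is a limit of real matrices, so the scalar series are
   summed through their real parts t |-> Re (z e^(lam t)), which are identified
   by their differential equation. *)
Require Import Defs.
From HB Require Import structures.
From mathcomp Require Import all_boot all_order all_algebra all_field.
From mathcomp Require Import all_classical all_reals all_analysis.
From mathcomp Require Import complex ring zify.

Set Implicit Arguments.
Unset Strict Implicit.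
Unset Printing Implicit Defensive.

Import Order.TTheory GRing.Theory Num.Theory.
Import numFieldNormedType.Exports.

Local Open Scope classical_set_scope.
Local Open Scope ring_scope.
Local Open Scope complex_scope.

(** * Truncations of a polynomial and divided differences *)

Lemma horner_drop_polyS (R : comNzRingType) (n : nat) (f : {poly R}) (x : R) :
  (drop_poly n f).[x] = f`_n + (drop_poly n.+1 f).[x] * x.
Proof.
have -> : drop_poly n f = (f`_n)%:P + drop_poly n.+1 f * 'X.
  apply/polyP=> i; rewrite !coefE; case: i => [|i] /=; first by rewrite addr0.
  by rewrite add0r addSnnS.
by rewrite !hornerE.
Qed.

Lemma drop_poly_monic (R : nzRingType) (f : {poly R}) :
  f \is monic -> drop_poly (size f).-1 f = 1.
Proof.
move=> /monicP f1; apply/polyP=> -[|i]; rewrite coef_drop_poly coef1.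
  by rewrite add0n -lead_coefE f1.
by rewrite nth_default// addSnnS; case: (size f) => [|n]//=; rewrite leq_addl.
Qed.

(* The truncations of [f] at [x] are the coefficients of the divided difference
   (f(X) - f(x)) / (X - x). *)
Lemma divided_difference_drop_poly (R : comNzRingType) (n : nat) (f : {poly R})
    (x : R) : (size f <= n.+1)%N ->
  (\sum_(k < n) (drop_poly k.+1 f).[x] *: 'X^k) * ('X - x%:P) = f - f.[x]%:P.
Proof.
have partial m : (\sum_(k < m) (drop_poly k.+1 f).[x] *: 'X^k) * ('X - x%:P) =
    take_poly m f + (drop_poly m f).[x] *: 'X^m - f.[x]%:P.
  elim: m => [|m IHm].
    by rewrite big_ord0 take_poly0l drop_poly0l -mul_polyC mul0r; ring.
  have -> : take_poly m.+1 f = take_poly m f + f`_m *: 'X^m.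
    apply/polyP=> i; rewrite !coefE ltnS leq_eqVlt.
    by case: ltngtP => [_|_|->] /=; rewrite ?mulr0 ?mulr1 ?addr0 ?add0r.
  rewrite big_ord_recr mulrDl IHm (horner_drop_polyS m) -!mul_polyC exprS.
  by rewrite rmorphD rmorphM /=; ring.
move=> sf; rewrite partial; congr (_ - _).
have dE : drop_poly n f = (f`_n)%:P.
  apply/polyP=> [[|i]]; rewrite !coefE//= nth_default//.
  by rewrite (leq_trans sf)// addSn ltnS leq_addl.
by rewrite -[RHS](poly_take_drop n) dE hornerC mul_polyC.
Qed.

(** Differentiate the divided difference identity and evaluate at [x], where the factor ['X - x%:P]
    kills one summand. *)
Lemma sum_drop_poly_deriv (R : comNzRingType) (n : nat) (f : {poly R}) (x : R) :
  (size f <= n.+1)%N ->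
  \sum_(k < n) (drop_poly k.+1 f).[x] * x ^+ k = f^`().[x].
Proof.
move=> /(divided_difference_drop_poly x)/(congr1 deriv).
rewrite derivM !derivB derivX !derivC !subr0 mulr1.
move/(congr1 (horner^~ x)); rewrite hornerD hornerM hornerXsubC subrr mulr0.
rewrite add0r => <-; rewrite horner_sum.
by apply: eq_bigr => k _; rewrite !hornerE.
Qed.

Lemma sum_drop_poly_root (R : idomainType) (n : nat) (f : {poly R}) (x y : R) :
  (size f <= n.+1)%N -> root f x -> root f y -> y != x ->
  \sum_(k < n) (drop_poly k.+1 f).[x] * y ^+ k = 0.
Proof.
move=> /(divided_difference_drop_poly x)/(congr1 (horner^~ y)).
rewrite hornerM hornerXsubC hornerD hornerN hornerC horner_sum.
move=> + /eqP fx /eqP fy yx.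
rewrite fx fy subr0 => /eqP; rewrite mulf_eq0 subr_eq0 (negbTE yx) orbF => /eqP.
by move=> E; rewrite -[RHS]E; apply: eq_bigr => k _; rewrite !hornerE.
Qed.

(** A product of distinct linear factors is separable, that is, coprime to its derivative, so the
    two share no root. *)
Lemma deriv_prod_XsubC_neq0 (F : fieldType) (n : nat) (r : 'I_n -> F)
    (f : {poly F}) (j : 'I_n) :
  injective r -> f = \prod_(i < n) ('X - (r i)%:P) -> f^`().[r j] != 0.
Proof.
move=> r_inj ->.
have E : \prod_(i < n) ('X - (r i)%:P) = \prod_(z <- codom r) ('X - z%:P).
  by rewrite /codom /image_mem big_map big_enum.
have : separable_poly (\prod_(i < n) ('X - (r i)%:P)).
  by rewrite E separable_prod_XsubC; exact/injectiveP.
rewrite separable_poly.unlock => /coprimep_root; apply.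
by rewrite E root_prod_XsubC codom_f.
Qed.

(** Reversing the order of summation turns the alpha-indexed truncation into a shift of
    coefficients, the form used for divided differences. *)
Lemma polyC_of_real_truncated_poly (R : realType) (p : nat) (a : {poly R})
    (k : nat) : (k <= p)%N -> (size a <= p.+1)%N ->
  polyC_of_real (truncated_poly p a k) = drop_poly k (polyC_of_real a).
Proof.
move=> kp sa; apply/polyP=> i; rewrite coef_drop_poly !coef_map; congr (_%:C).
rewrite /truncated_poly (reindex_inj rev_ord_inj) /= coef_sumMXn.
case: (leqP (i + k) p) => ikp.
  have ip : (i < (p - k).+1)%N by rewrite ltnS leq_subRL// addnC.
  rewrite (big_pred1 (Ordinal ip)) /= => [|l].
    congr _`_ _; lia.
  rewrite /= [RHS]/eq_op /=; have := ltn_ord l; lia.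
rewrite nth_default ?(leq_trans sa)// big1// => l /eqP.
have := ltn_ord l; lia.
Qed.

(** * Spectral decomposition of a companion matrix with simple eigenvalues *)

Lemma distinct_roots_enum (R : realType) (p : nat) (a : {poly R}) :
  a \is monic -> size a = p.+1 -> distinct_roots a ->
  exists2 r : 'I_p -> R[i], injective r &
    polyC_of_real a = \prod_(j < p) ('X - (r j)%:P).
Proof.
move=> /monicP a1 sa [r r_uniq]; rewrite a1 rmorph1 scale1r => ar.
have sr : size r = p.
  by apply: succn_inj; rewrite -(size_prod_XsubC r id) -ar size_map_poly.
exists (fun j => r`_j).
  by move=> i j /eqP; rewrite nth_uniq ?sr// => /eqP/val_inj.
by rewrite ar (big_nth 0) sr big_mkord.
Qed.

(* The columns of [right_eigenmx r] and the rows of [left_eigenmx f r] are dual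
   bases of right and left eigenvectors of the companion matrix of [f], whose
   roots are the [r j]. *)
Definition right_eigenmx (F : fieldType) (p : nat) (r : 'I_p -> F) : 'M[F]_p :=
  \matrix_(i, j) r j ^+ i.

Definition left_eigenmx (F : fieldType) (p : nat) (f : {poly F})
    (r : 'I_p -> F) : 'M[F]_p :=
  \matrix_(j, l) ((drop_poly l.+1 f).[r j] / f^`().[r j]).

Lemma right_eigenmxK (F : fieldType) (p : nat) (f : {poly F}) (r : 'I_p -> F) :
  injective r -> f = \prod_(j < p) ('X - (r j)%:P) ->
  right_eigenmx r *m left_eigenmx f r = 1%:M.
Proof.
(* Duality of the bases is the product in the opposite order; for square matrices a one-sided
   inverse is two-sided. *)
move=> r_inj fr; apply/mulmx1C/matrixP=> i j; rewrite !mxE.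
have sf : (size f <= p.+1)%N.
  by rewrite fr size_prod_XsubC /index_enum -enumT size_enum_ord.
have fr0 k : root f (r k).
  rewrite fr /root horner_prod (bigD1 k)//= hornerXsubC subrr mul0r; exact/eqP.
have -> : \sum_k left_eigenmx f r i k * right_eigenmx r k j =
    (\sum_(k < p) (drop_poly k.+1 f).[r i] * r j ^+ k) / f^`().[r i].
  by rewrite mulr_suml; apply: eq_bigr => k _; rewrite !mxE mulrAC.
have [->|ij] := eqVneq i j.
  by rewrite sum_drop_poly_deriv// divff// (deriv_prod_XsubC_neq0 _ r_inj).
by rewrite sum_drop_poly_root ?mul0r// (inj_eq r_inj) eq_sym.
Qed.

(** Rows above the last shift the powers of [r j]; the last row expresses [r j ^+ p] through lower
    powers because [r j] is a root. *)
Lemma companion_right_eigenmx (R : realType) (p : nat) (a : {poly R})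
    (r : 'I_p -> R[i]) :
  polyC_of_real a = \prod_(j < p) ('X - (r j)%:P) ->
  map_mx (real_complex R) (companion p a) *m right_eigenmx r =
  right_eigenmx r *m diag_mx (\row_j r j).
Proof.
move=> ar; apply/matrixP=> i j; rewrite mul_mx_diag !mxE -exprSr.
have [ip|ip] := eqVneq i.+1 p; last first.
  have ilt : (i.+1 < p)%N by rewrite ltn_neqAle ip ltn_ord.
  rewrite (bigD1 (Ordinal ilt))//= big1 => [|k]; rewrite !mxE (negbTE ip).
    by rewrite eqxx rmorph1 mul1r addr0.
  by rewrite -val_eqE /= => /negbTE ->; rewrite rmorph0 mul0r.
have f_monic : polyC_of_real a \is monic by rewrite ar monic_prod_XsubC.
have sf : size (polyC_of_real a) = p.+1.
  by rewrite ar size_prod_XsubC /index_enum -enumT size_enum_ord.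
have : (polyC_of_real a).[r j] = 0.
  by rewrite ar horner_prod (bigD1 j)//= hornerXsubC subrr mul0r.
rewrite horner_coef sf big_ord_recr /=.
move: f_monic; rewrite monicE lead_coefE sf /= => /eqP ->; rewrite mul1r.
rewrite ip => /eqP; rewrite addrC addr_eq0 => /eqP ->.
rewrite -sumrN; apply: eq_bigr => k _; rewrite !mxE ip eqxx coef_map /=.
by rewrite rmorphN mulNr.
Qed.

(** With [D] the diagonal matrix of roots, [A V = V D] and [V W = 1] give [A ^+ n = V D ^+ n W],
    read here entry by entry. *)
Lemma companionX_spectral (R : realType) (p : nat) (a : {poly R})
    (r : 'I_p -> R[i]) (n : nat) (i l : 'I_p) :
  injective r -> polyC_of_real a = \prod_(j < p) ('X - (r j)%:P) ->
  ((companion p a ^+ n) i l)%:C =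
  \sum_j r j ^+ i * (left_eigenmx (polyC_of_real a) r j l) * r j ^+ n.
Proof.
move=> r_inj ar; set V := right_eigenmx r.
have AV : map_mx (real_complex R) (companion p a ^+ n) *m V =
    V *m diag_mx (\row_j r j ^+ n).
  elim: n => [|n IHn].
    rewrite expr0 map_mx1 mul1mx; apply/matrixP=> k m.
    by rewrite mul_mx_diag !mxE expr0 mulr1.
  rewrite exprS map_mxM -mulmxA IHn mulmxA companion_right_eigenmx// -mulmxA.
  rewrite mulmx_diag; congr (_ *m diag_mx _); apply/rowP=> k.
  by rewrite !mxE exprS.
have -> : ((companion p a ^+ n) i l)%:C =
    map_mx (real_complex R) (companion p a ^+ n) i l by rewrite mxE.
rewrite -[map_mx _ _]mulmx1 -(right_eigenmxK r_inj ar) mulmxA AV mxE.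
by apply: eq_bigr => j _; rewrite mul_mx_diag !mxE mulrAC.
Qed.

(** [eigenvalue] refers to row vectors: if [u A = z u], then [u V] is nonzero and [z] equals [r j]
    wherever its entry [j] is nonzero. Conversely, row [j] of [W] is an eigenvector for [r j]. *)
Lemma eigenvalue_companion (R : realType) (p : nat) (a : {poly R})
    (r : 'I_p -> R[i]) (z : R[i]) :
  injective r -> polyC_of_real a = \prod_(j < p) ('X - (r j)%:P) ->
  eigenvalue (map_mx (real_complex R) (companion p a)) z = (z \in codom r).
Proof.
move=> r_inj ar; set V := right_eigenmx r.
set W := left_eigenmx (polyC_of_real a) r.
set A := map_mx _ _.
have VW : V *m W = 1%:M by exact: right_eigenmxK.
have AV : A *m V = V *m diag_mx (\row_j r j) by exact: companion_right_eigenmx.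
have WV := mulmx1C VW.
apply/eigenvalueP/codomP => [[u uA u0]|[j ->]].
  have uV0 : u *m V != 0.
    by apply: contra u0 => /eqP uV; rewrite -[u]mulmx1 -VW mulmxA uV mul0mx.
  have /rV0Pn[j uVj] := uV0; exists j.
  have : z *: (u *m V) = u *m V *m diag_mx (\row_j r j).
    by rewrite scalemxAl -uA -!mulmxA AV.
  move: (u *m V) uVj => w wj /rowP/(_ j).
  by rewrite mul_mx_diag !mxE mulrC => /(mulfI wj).
have WA : W *m A = diag_mx (\row_j r j) *m W.
  by rewrite -[LHS]mulmx1 -VW mulmxA -(mulmxA W) AV !mulmxA WV mul1mx.
exists (row j W).
  rewrite -row_mul WA; apply/rowP=> l.
  by rewrite mul_diag_mx !mxE.
apply/eqP => Wj.
have /rowP/(_ j)/eqP : row j (W *m V) = row j 1%:M by rewrite WV.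
by rewrite row_mul Wj mul0mx !mxE eqxx eq_sym oner_eq0.
Qed.

(** * Real parts of complex exponential series *)

(* Coefficients of the real power series of [t |-> Re (z e^(lam t))]. *)
Definition Re_exp_coef (R : realType) (z lam : R[i]) (n : nat) : R :=
  complex.Re (z * lam ^+ n) / n`!%:R.

(** Real linearity in [w]. Thus the series for [z] and [z * 'i] form a system closed under
    differentiation, which multiplies [z] by [lam]. *)
Lemma Re_exp_coef_linear (R : realType) (z lam w : R[i]) :
  Re_exp_coef (z * w) lam = complex.Re w *: Re_exp_coef z lam +
    complex.Im w *: Re_exp_coef (z * 'i) lam.
Proof.
apply/funext => n; rewrite !fctE /Re_exp_coef /GRing.scale /=.
rewrite !mulrA -mulrDl; congr (_ / _).
case: z w (lam ^+ n) => [z1 z2] [w1 w2] [l1 l2] /=; ring.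
Qed.

Lemma pseries_diffs_Re_exp_coef (R : realType) (z lam : R[i]) :
  pseries_diffs (Re_exp_coef z lam) = Re_exp_coef (z * lam) lam.
Proof.
apply/funext => n; rewrite /pseries_diffs /Re_exp_coef exprS mulrA factS natrM.
by rewrite invfM mulrCA mulVKf.
Qed.

(** Domination by the series of [|z| e^(|lam| |t|)]. Norms on [R[i]] are complex-valued, so the
    moduli enter through their real parts [c] and [m]. *)
Lemma is_cvg_Re_exp_series (R : realType) (z lam : R[i]) (t : R) :
  cvgn (pseries (Re_exp_coef z lam) t).
Proof.
apply: normed_cvg; rewrite /normed_series_of /=.
set c := complex.Re `|z|; set m := complex.Re `|lam|.
have cE : c%:C = `|z| by rewrite RRe_real// normr_real.
have mE : m%:C = `|lam| by rewrite RRe_real// normr_real.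
have c0 : 0 <= c by rewrite -lecR cE rmorph0.
have m0 : 0 <= m by rewrite -lecR mE rmorph0.
apply: (@series_le_cvg _ _ (c *: exp_coeff (m * `|t|))) => [n|n|n|].
- exact: normr_ge0.
- by rewrite mulr_ge0// divr_ge0// exprn_ge0// mulr_ge0.
- rewrite /Re_exp_coef /= !normrM normfV normrX normr_nat.
  have -> : (c *: exp_coeff (m * `|t|)) n = c * m ^+ n / n`!%:R * `|t| ^+ n.
    by rewrite fctE /exp_coeff /GRing.scale /= exprMn; ring.
  rewrite ler_wpM2r ?exprn_ge0// ler_wpM2r ?invr_ge0//.
  by rewrite -lecR rmorphM rmorphXn /= cE mE -normrX -normrM normc_ge_Re.
- by apply: is_cvg_seriesZ; exact: is_cvg_series_exp_coeff.
Qed.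

Definition Re_exp_series (R : realType) (z lam : R[i]) (t : R) : R :=
  limn (pseries (Re_exp_coef z lam) t).

Lemma Re_exp_series0 (R : realType) (z lam : R[i]) :
  Re_exp_series z lam 0 = complex.Re z.
Proof.
apply: lim_near_cst => //; near=> n.
rewrite -[n]prednK; last by near: n.
rewrite /pseries /series /= big_nat_recl//= big1 => [|i _].
  by rewrite /Re_exp_coef !expr0 !mulr1 fact0 divr1 addr0.
by rewrite expr0n mulr0.
Unshelve. all: by end_near. Qed.

Lemma Re_exp_series_linear (R : realType) (z lam w : R[i]) (t : R) :
  Re_exp_series (z * w) lam t = complex.Re w * Re_exp_series z lam t +
    complex.Im w * Re_exp_series (z * 'i) lam t.
Proof.
have ->: Re_exp_series (z * w) lam t = limn (series
    (complex.Re w *: (fun n => Re_exp_coef z lam n * t ^+ n) +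
     complex.Im w *: (fun n => Re_exp_coef (z * 'i) lam n * t ^+ n))).
  rewrite /Re_exp_series /pseries Re_exp_coef_linear; congr (limn (series _)).
  by apply/funext => n; rewrite !fctE /= mulrDl /GRing.scale /= !mulrA.
have cvg1 := @is_cvg_Re_exp_series R z lam t.
have cvg2 := @is_cvg_Re_exp_series R (z * 'i) lam t.
rewrite lim_seriesD; [|exact: is_cvg_seriesZ|exact: is_cvg_seriesZ].
by rewrite !lim_seriesZ.
Qed.

Lemma Re_exp_series_mulii (R : realType) (z lam : R[i]) (t : R) :
  Re_exp_series (z * 'i * 'i) lam t = - Re_exp_series z lam t.
Proof.
have ii : 'i * 'i = -1 :> R[i] by rewrite -expr2 sqr_i.
by rewrite -mulrA ii Re_exp_series_linear /= oppr0 mul0r addr0 mulN1r.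
Qed.

Lemma is_derive_Re_exp_series (R : realType) (z lam : R[i]) (t : R) :
  is_derive t (1 : R) (Re_exp_series z lam) (Re_exp_series (z * lam) lam t).
Proof.
rewrite /Re_exp_series -pseries_diffs_Re_exp_coef.
(* The series converges everywhere, so any point of modulus beyond [|t|] serves for termwise
   differentiation. *)
apply: (@pseries_snd_diffs _ _ (`|t| + 1)).
- exact: is_cvg_Re_exp_series.
- by rewrite pseries_diffs_Re_exp_coef; exact: is_cvg_Re_exp_series.
- by rewrite !pseries_diffs_Re_exp_coef; exact: is_cvg_Re_exp_series.
- by rewrite [ltRHS]ger0_norm ?addr_ge0// ltrDl.
Qed.

(* The left-hand side is Re (W(t) e^(- lam t)) where W(t) is the sum of the
   complex series z e^(lam t), whose imaginary part is
   [- Re_exp_series (z * 'i) lam t]; hence it is constant. *)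
Lemma Re_exp_series_twist (R : realType) (z lam : R[i]) (t : R) :
  expR (- complex.Re lam * t) *
    (Re_exp_series z lam t * cos (complex.Im lam * t) -
     Re_exp_series (z * 'i) lam t * sin (complex.Im lam * t)) = complex.Re z.
Proof.
set x := complex.Re lam; set y := complex.Im lam.
pose A := Re_exp_series z lam; pose B := Re_exp_series (z * 'i) lam.
pose e := expR \o ( *%R (- x)); pose c := cos \o ( *%R y).
pose s := sin \o ( *%R y).
have dl (k u : R) : is_derive u (1 : R) ( *%R k) k.
  have -> : *%R k = k *: (id : R -> R) by [].
  by apply: is_derive_eq; rewrite /GRing.scale /= mulr1.
suff dphi u : is_derive u (1 : R) (e * (A * c - B * s)) 0.
  have := is_derive_0_is_cst t 0 dphi; rewrite !fctE => ->.
  by rewrite /e /c /s /= !mulr0 expR0 cos0 sin0 /A Re_exp_series0; ring.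
have de : is_derive u (1 : R) e (e u * - x) by exact: is_derive1_comp.
have dc : is_derive u (1 : R) c (- s u * y).
  by apply: is_derive1_comp; exact: is_derive_cos.
have ds : is_derive u (1 : R) s (c u * y).
  by apply: is_derive1_comp; exact: is_derive_sin.
have dA : is_derive u (1 : R) A (x * A u + y * B u).
  by have := is_derive_Re_exp_series z lam u; rewrite Re_exp_series_linear.
have dB : is_derive u (1 : R) B (x * B u - y * A u).
  have := is_derive_Re_exp_series (z * 'i) lam u; rewrite Re_exp_series_linear.
  by rewrite Re_exp_series_mulii mulrN.
apply: is_derive_eq.
rewrite !fctE /GRing.scale /=; ring.
Qed.

Lemma Re_exp_series_cvg (R : realType) (z lam : R[i]) (t : R) :
  pseries (Re_exp_coef z lam) t @ \oo --> complex.Re (z * expC (lam * t%:C)).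
Proof.
suff <- : Re_exp_series z lam t = complex.Re (z * expC (lam * t%:C)).
  exact: is_cvg_Re_exp_series.
have := Re_exp_series_twist (z * 'i) lam t; have := Re_exp_series_twist z lam t.
rewrite Re_exp_series_mulii mulNr expRN.
case: lam => x y; set A := Re_exp_series _ _ _.
set B := Re_exp_series _ _ _ => /=.
have e0 : (expR (x * t))^-1 != 0 by rewrite invr_eq0 gt_eqF// expR_gt0.
move=> /(canRL (mulKf e0)); rewrite invrK => ReE.
move=> /(canRL (mulKf e0)); rewrite invrK => ImE.
(* The two twisted identities give the rotation of [(A, B)] by the angle [y * t]; rotating back
   recovers [A]. *)
transitivity ((A * cos (y * t) - B * sin (y * t)) * cos (y * t) +
    (B * cos (y * t) - - A * sin (y * t)) * sin (y * t)).
  rewrite -[LHS]mulr1 -(cos2Dsin2 (y * t)); ring.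
rewrite ReE ImE /expC.
case: z {A B ReE ImE} => z1 z2 /=.
rewrite !mulr0 !mul0r !subr0 ?addr0 ?add0r; ring.
Qed.

(** * The exponential of a companion matrix *)

(** A neighbourhood of a matrix contains a box of entrywise neighbourhoods, and there are only
    finitely many entries. *)
Lemma cvg_mx (R : realType) (m n : nat) (u : nat -> 'M[R]_(m, n))
    (M : 'M[R]_(m, n)) :
  (forall i j, (fun k => u k i j) @ \oo --> M i j) -> u @ \oo --> M.
Proof.
move=> uM A [P nP PA].
have uP : \forall k \near \oo, forall i j, P i j (u k i j).
  by apply: filter_forall => i; apply: filter_forall => j; exact/uM/nP.
by apply: filterS uP => k ukP; exact: PA.
Qed.

Lemma exprZmx (R : comPzRingType) (n k : nat) (t : R) (A : 'M[R]_n) :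
  (t *: A) ^+ k = t ^+ k *: A ^+ k.
Proof.
elim: k => [|k IHk]; first by rewrite !expr0 scale1r.
by rewrite !exprS IHk -!mulmxE -scalemxAl -scalemxAr scalerA.
Qed.

Lemma Re_sum (R : rcfType) (I : Type) (s : seq I) (P : pred I) (F : I -> R[i]) :
  complex.Re (\sum_(i <- s | P i) F i) = \sum_(i <- s | P i) complex.Re (F i).
Proof. by apply: (big_morph _ _ erefl) => -[? ?] [? ?]. Qed.

Lemma expmx_companion (R : realType) (p : nat) (a : {poly R}) (r : 'I_p -> R[i])
    (t : R) (i l : 'I_p) :
  injective r -> polyC_of_real a = \prod_(j < p) ('X - (r j)%:P) ->
  (expmx (t *: companion p a) i l)%:C =
  \sum_j r j ^+ i * (left_eigenmx (polyC_of_real a) r j l) * expC (r j * t%:C).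
Proof.
move=> r_inj ar; set A := companion p a.
pose S (k m : 'I_p) := \sum_j r j ^+ k *
  (left_eigenmx (polyC_of_real a) r j m) * expC (r j * t%:C).
(* The weight [w] is a test factor: ['i] shows that the limit [S] is real, and 1 then identifies it
   with the exponential. *)
have cvgw w i' l' : (fun n => \sum_(0 <= k < n)
    complex.Re (w * ((A ^+ k) i' l')%:C) / k`!%:R * t ^+ k) @ \oo -->
    complex.Re (w * S i' l').
  pose Q j := w * (r j ^+ i' * left_eigenmx (polyC_of_real a) r j l').
  have -> : (fun n => \sum_(0 <= k < n)
      complex.Re (w * ((A ^+ k) i' l')%:C) / k`!%:R * t ^+ k) =
      (fun n => \sum_j pseries (Re_exp_coef (Q j) (r j)) t n).
    apply/funext => n; rewrite exchange_big /=; apply: eq_bigr => k _.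
    rewrite (companionX_spectral _ _ _ r_inj ar) mulr_sumr Re_sum !mulr_suml.
    by apply: eq_bigr => j _; rewrite /Re_exp_coef /Q !mulrA.
  rewrite mulr_sumr Re_sum.
  apply: cvg_big; first exact: add_continuous.
  move=> j _; rewrite mulrA; exact: Re_exp_series_cvg.
(* [- Im S] is the real part of ['i * S], the limit of sums whose terms all vanish because [A] is
   real. *)
have ImS i' l' : complex.Im (S i' l') = 0.
  apply/eqP; rewrite -oppr_eq0 -ReiNIm mulrC; apply/eqP.
  rewrite -(cvg_lim _ (cvgw 'i i' l'))//.
  rewrite [X in lim (X @ _)](_ : _ = fun=> 0); first exact: lim_cst.
  apply/funext => n; rewrite big1// => k _ /=.
  by rewrite mul0r mulr0 subr0 !mul0r.
have -> : expmx (t *: A) = \matrix_(i', l') complex.Re (S i' l').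
  apply: cvg_lim => //.
  apply: cvg_mx => i' l'; rewrite mxE -[X in complex.Re X]mul1r.
  rewrite [X in X @ _ --> _](_ : _ = fun n => \sum_(0 <= k < n)
    complex.Re (1 * ((A ^+ k) i' l')%:C) / k`!%:R * t ^+ k); first exact: cvgw.
  apply/funext => n; rewrite /series /= summxE; apply: eq_bigr => k _.
  by rewrite exprZmx scalerA mxE mul1r /=; ring.
rewrite mxE -/(S i l) [RHS]complexE ImS rmorph0 mulr0 addr0.
by [].
Qed.

(** * Expansion of the kernel over index tuples and eigenvalue tuples *)

Lemma expC0 (R : realType) : expC (0 : R[i]) = 1.
Proof. by rewrite /expC /= expR0 cos0 sin0 rmorph1 mul1r. Qed.

Lemma expCD (R : realType) (z w : R[i]) : expC (z + w) = expC z * expC w.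
Proof.
case: z w => [z1 z2] [w1 w2]; rewrite /expC /= expRD cosD sinD rmorphM.
by apply/eqP; rewrite eq_complex /=; apply/andP; split; apply/eqP; ring.
Qed.

Lemma sum_ffun_recl (V : nmodType) (d : nat) (T : finType)
    (F : {ffun 'I_d.+1 -> T} -> V) :
  \sum_k F k = \sum_m \sum_(k : {ffun 'I_d -> T})
    F [ffun i => oapp k m (unlift ord0 i)].
Proof.
rewrite pair_big /=.
rewrite (reindex (fun mk : T * {ffun 'I_d -> T} =>
  [ffun i => oapp mk.2 mk.1 (unlift ord0 i)] : {ffun 'I_d.+1 -> T}))//=.
exists (fun k : {ffun 'I_d.+1 -> T} => (k ord0, [ffun i => k (lift ord0 i)])).
  move=> [m k] _ /=; rewrite ffunE unlift_none /=; congr pair.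
  by apply/ffunP => i; rewrite !ffunE liftK.
move=> k _; apply/ffunP => i; rewrite ffunE /=.
by case: unliftP => [j|] -> //=; rewrite ffunE.
Qed.

(** A sum over paths: [k i] is the row index of the factor [M i]. The last factor is merged with
    [c], leaving [d] transitions; the induction absorbs the first factor into [u]. *)
Lemma row_prod_col_mx (R : comPzRingType) (d p : nat) (u : 'rV[R]_p)
    (M : 'I_d.+1 -> 'M[R]_p) (c : 'cV[R]_p) :
  (u *m (\prod_(i < d.+1) M i) *m c) 0 0 =
  \sum_(k : {ffun 'I_d.+1 -> 'I_p})
    u 0 (k ord0) * (M ord_max *m c) (k ord_max) 0 *
    \prod_(i < d) M (widen_ord (leqnSn d) i)
      (k (widen_ord (leqnSn d) i)) (k (lift ord0 i)).
Proof.
elim: d u M => [|d IHd] u M; rewrite sum_ffun_recl.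
  rewrite big_ord1 -mulmxA mxE; apply: eq_bigr => m _.
  rewrite (big_pred1 [ffun i => m]) => [|k].
    by rewrite big_ord0 mulr1 !ffunE (ord1 ord_max) unlift_none.
  by apply/esym/eqP/ffunP => -[].
rewrite big_ord_recl mulmxA IHd exchange_big /=; apply: eq_bigr => k _.
rewrite mxE !mulr_suml; apply: eq_bigr => m _.
rewrite big_ord_recl !ffunE unlift_none /=.
have -> : ord_max = lift ord0 (ord_max : 'I_d.+1) by exact/val_inj.
have -> : widen_ord (leqnSn d.+1) ord0 = ord0 by exact/val_inj.
rewrite !liftK unlift_none /=.
rewrite [in RHS](eq_bigr (fun i : 'I_d => M (lift ord0 (widen_ord (leqnSn d) i))
    (k (widen_ord (leqnSn d) i)) (k (lift ord0 i)))) => [|i _]; first by ring.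
have -> : widen_ord (leqnSn d.+1) (lift ord0 i) =
  lift ord0 (widen_ord (leqnSn d) i) by exact/val_inj.
by rewrite !ffunE !liftK.
Qed.

Lemma eigenvalue_tuples_companion (R : realType) (d p : nat)
    (a : 'I_d -> {poly R}) (r : 'I_d -> 'I_p -> R[i]) :
  (forall i, injective (r i)) ->
  (forall i, polyC_of_real (a i) = \prod_(j < p) ('X - (r i j)%:P)) ->
  eigenvalue_tuples (fun i => companion p (a i)) =
  [set [ffun i => r i (J i)] | J in [set: {ffun 'I_d -> 'I_p}]].
Proof.
move=> r_inj ar; apply/seteqP; split=> [lam lamE|_ [J _ <-] i].
  have {lamE} /choice[J JE] : forall i, exists j, r i j = lam i.
    move=> i; have := lamE i; rewrite (eigenvalue_companion _ (r_inj i) (ar i)).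
    by move=> /codomP[j ->]; exists j.
  by exists (finfun J) => //; apply/ffunP => i; rewrite !ffunE.
by rewrite ffunE (eigenvalue_companion _ (r_inj i) (ar i)) codom_f.
Qed.

Lemma fsbig_eigenvalue_tuples (R : realType) (d p : nat)
    (a : 'I_d -> {poly R}) (r : 'I_d -> 'I_p -> R[i])
    (F : {ffun 'I_d -> R[i]} -> R[i]) :
  (forall i, injective (r i)) ->
  (forall i, polyC_of_real (a i) = \prod_(j < p) ('X - (r i j)%:P)) ->
  \sum_(lam \in eigenvalue_tuples (fun i => companion p (a i))) F lam =
  \sum_(J : {ffun 'I_d -> 'I_p}) F [ffun i => r i (J i)].
Proof.
move=> r_inj ar; rewrite (eigenvalue_tuples_companion r_inj ar) fsbig_image.
  rewrite (_ : [set: _] = [set` predT]); last by apply/seteqP; split.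
  rewrite -(@bigfs _ _ _ _ (index_enum _))// ?index_enum_uniq// => J _.
  by rewrite mem_index_enum.
(* Simple roots make the parametrization of eigenvalue tuples by [J] one-to-one. *)
move=> J K _ _ /ffunP JK; apply/ffunP => i.
by have := JK i; rewrite !ffunE => /r_inj.
Qed.


(* The dimension is d.+1 >= 1. The 0-based index i : 'I_d.+1 stands for i + 1,
   and likewise (k i).+1 ranges over 1..p. *)
Theorem theorem3p10 (R : realType) (d p : nat) (q : 'I_p) (b : 'cV[R]_p)
    (a : 'I_d.+1 -> {poly R})
    (hbq : b q 0 != 0)
    (hb0 : forall i : 'I_p, (q < i)%N -> b i 0 = 0)
    (ha_monic : forall i, a i \is monic)
    (ha_deg : forall i, size (a i) = p.+1)
    (ha_stable : forall i (z : R[i]),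
       root (polyC_of_real (a i)) z -> complex.Re z < 0)
    (ha_distinct : forall i, distinct_roots (a i))
    (s : 'cV[R]_d.+1) :
  (carma_kernel b (fun i => companion p (a i)) s)%:C =
  \sum_(lam \in eigenvalue_tuples (fun i => companion p (a i)))
    ((\sum_(k : {ffun 'I_d.+1 -> 'I_p})
        (b (k ord0) 0)%:C
        * (lam ord_max ^+ k ord_max
           / (polyC_of_real (a ord_max)^`()).[lam ord_max])
        * \prod_(i < d)
            (let i0 := widen_ord (leqnSn d) i in
             let i1 := lift ord0 i in
             lam i0 ^+ k i0
             * (polyC_of_real (truncated_poly p (a i0) (k i1).+1)).[lam i0]
             / (polyC_of_real (a i0)^`()).[lam i0]))
     * expC (\sum_(i < d.+1) lam i * (s i 0)%:C)
     * (ge0_ind s)%:C).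
Proof.
have p0 : (0 < p)%N by exact: leq_ltn_trans (ltn_ord q).
have [r r_inj ar] : exists2 r : 'I_d.+1 -> 'I_p -> R[i],
    (forall i, injective (r i)) &
    forall i, polyC_of_real (a i) = \prod_(j < p) ('X - (r i j)%:P).
  have /choice[r rP] : forall i, exists ri : 'I_p -> R[i], injective ri /\
      polyC_of_real (a i) = \prod_(j < p) ('X - (ri j)%:P).
    move=> i.
    have [ri ? ?] :=
      distinct_roots_enum (ha_monic i) (ha_deg i) (ha_distinct i).
    by exists ri.
  by exists r => i; have [] := rP i.
rewrite (fsbig_eigenvalue_tuples _ r_inj ar).
rewrite /carma_kernel rmorphM /= -mulr_suml; congr (_ * _).
rewrite row_prod_col_mx rmorph_sum.
under [RHS]eq_bigr do rewrite mulr_suml.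
(* From here on the index tuple [k] is fixed. *)
rewrite [RHS]exchange_big /=; apply: eq_bigr => k _.
have lp : (p.-1 < p)%N by rewrite ltn_predL.
(* Column index of factor [i]: the row index of the next factor, or [p.-1] for the last one, since
   [c] is the last unit vector. *)
pose nxt (i : 'I_d.+1) : 'I_p :=
  if unlift ord_max i is Some i' then k (lift ord0 i') else Ordinal lp.
pose W i j m := left_eigenmx (polyC_of_real (a i)) (r i) j m.
pose e i j := expC (r i j * (s i 0)%:C).
have entryE i m n : (expmx (s i 0 *: companion p (a i)) m n)%:C =
    \sum_j r i j ^+ m * W i j n * e i j.
  exact: expmx_companion.
have nxt_max : nxt ord_max = Ordinal lp by rewrite /nxt unlift_none.
have nxt_widen i : nxt (widen_ord (leqnSn d) i) = k (lift ord0 i).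
  have -> : widen_ord (leqnSn d) i = lift ord_max i.
    by apply/val_inj; rewrite /= /bump leqNgt ltn_ord.
  by rewrite /nxt liftK.
transitivity ((b (k ord0) 0)%:C *
    \prod_i \sum_j r i j ^+ k i * W i j (nxt i) * e i j).
  rewrite big_ord_recr /= nxt_max -entryE !rmorphM rmorph_prod /= -!mulrA mxE.
  congr (_ * _); rewrite mulrC; congr (_ * _).
    by apply: eq_bigr => i _; rewrite entryE nxt_widen.
  have -> : unit_vector_last R p = delta_mx (Ordinal lp) 0.
    apply/colP => i; rewrite !mxE eqxx andbT -val_eqE /=.
    by rewrite -[X in _ == X](prednK p0) eqSS.
  by rewrite -colE mxE.
(* Distributivity turns the product of sums over roots into a sum over the choices [J] of one root
   per factor. *)
rewrite bigA_distr_bigA mulr_sumr; apply: eq_bigr => J _.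
rewrite (big_morph _ (@expCD R) (@expC0 R)) big_split /=.
rewrite [in RHS](eq_bigr (fun i => e i (J i))) => [|i _]; last by rewrite ffunE.
rewrite [LHS]mulrA; congr (_ * _).
have WE i j m : W i j m =
    (polyC_of_real (truncated_poly p (a i) m.+1)).[r i j] /
    (polyC_of_real (a i)^`()).[r i j].
  rewrite /W mxE polyC_of_real_truncated_poly ?ha_deg//.
  by rewrite /polyC_of_real deriv_map.
rewrite big_ord_recr /= nxt_max -[RHS]mulrA ffunE; congr (_ * _).
rewrite mulrC; congr (_ * _); last first.
  by apply: eq_bigr => i _; rewrite nxt_widen WE !ffunE mulrA.
have f_monic : polyC_of_real (a ord_max) \is monic by exact: monic_map.
have sf : size (polyC_of_real (a ord_max)) = p.+1 by rewrite size_map_poly.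
congr (_ * _); rewrite /W mxE prednK//.
(* The column index [p.-1] calls for the truncation of order [p], which is 1 for a monic polynomial
   of degree [p]; so [ord_max] contributes no truncated polynomial. *)
have -> : drop_poly p (polyC_of_real (a ord_max)) = 1.
  by rewrite -[p]/p.+1.-1 -sf drop_poly_monic.
by rewrite hornerC mul1r /polyC_of_real deriv_map.
Qed.
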